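(* Let $K$ be a field of characteristic zero, let $n,m\ge 0$ be integers with $2n+m\ge 1$, and let $\sigma\in \mathrm{Aut}_K(A_n\otimes P_m)$ be a $K$-algebra automorphism. Then $$\deg \sigma^{-1}\le (\deg\sigma)^{2n+m-1}.$$
   Context: $A_n$ is the $n$-th Weyl algebra over $K$: the $K$-algebra generated by $q_1,\dots,q_n,p_1,\dots,p_n$ subject to $[p_i,q_j]=\delta_{ij}$ (Kronecker delta), $[p_i,p_j]=[q_i,q_j]=0$, where $[a,b]=ab-ba$. $P_m=K[x_{2n+1},\dots,x_{2n+m}]$ is a polynomial algebra in $m$ variables ($A_0=P_0=K$). Put $A=A_n\otimes_K P_m$, $s=2n+m$, $x_i:=q_i$ and $x_{n+i}:=p_i$ for $1\le i\le n$. The ordered monomials $x^\alpha=x_1^{\alpha_1}\cdots x_s^{\alpha_s}$, $\alpha\in\mathbb{N}^s$, form a $K$-basis of $A$. For a nonzero $a=\sum_\alpha\lambda_\alpha x^\alpha\in A$ ($\lambda_\alpha\in K$), $\deg a:=\max\{\alpha_1+\cdots+\alpha_s : \lambda_\alpha\ne 0\}$. For $\sigma\in\mathrm{Aut}_K(A)$, $\deg\sigma:=\max\{\deg\sigma(x_i): i=1,\dots,s\}$. *)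

(* Defs.v *)
From HB Require Import structures.
From mathcomp Require Import all_boot all_order all_algebra.
From mathcomp Require Import ssrcomplements mpoly.
From mathcomp Require Import ring.

Set Implicit Arguments.
Unset Strict Implicit.
Unset Printing Implicit Defensive.

Import GRing.Theory.
Local Open Scope ring_scope.

(* A_n (x) P_m, written weylPoly K n m below, is realised on the K-vector space
   of normally ordered polynomials: with s = 2n + m, 'X_[alpha] stands for the
   ordered monomial x_1^alpha_1 ... x_s^alpha_s, where (0-based) x_i is q_i for
   i < n, p_(i-n) for n <= i < 2n, and a polynomial variable for i >= 2n.  The
   product is the left regular representation in these coordinates.
   - [wgen_rel] and [weyl_universal]: this is the K-algebra presented by the
     generators x_i and the relations [weyl_rel]; as the tensor product over K
     of two presented algebras has the union of the generators, the union of
     the relations, and commutation between the two families, this is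
     A_n (x) P_m;
   - [ordmonE], [ordmon_span], [ordmon_free]: the ordered products of the x_i
     are the 'X_[alpha] and form a K-basis, so the coefficients of an element
     as a polynomial are its coordinates lambda_alpha. *)

Section OrderedAction.
Variables (K : comNzRingType) (s : nat) (V : lmodType K).
Variable Y : 'I_s -> V -> V.

Definition ordact_seq (r : seq 'I_s) (al : 'X_{1..s}) (v : V) : V :=
  foldr (fun k w => iter (al k) (Y k) w) v r.

Definition ordact (al : 'X_{1..s}) (v : V) : V :=
  ordact_seq (enum 'I_s) al v.

(* \sum_al c_al x^al acts on v as \sum_al c_al Y_1^al_1 (Y_2^al_2 (... v)) *)
Definition polyact (c : {mpoly K[s]}) (v : V) : V :=
  \sum_(al <- msupp c) c@_al *: ordact al v.

End OrderedAction.

Section WeylIndices.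
Variables (n m : nat).

(* x_i = p_k and x_j = q_k for the same k *)
Definition pqpair (i j : 'I_(2 * n + m)) : bool :=
  (j < n)%N && (i == n + j :> nat).

Lemma pqpair_lt i j : pqpair i j -> (j < i)%N.
Proof.
by case/andP => jn /eqP ->; rewrite -[X in (X < _)%N]add0n ltn_add2r (leq_trans _ jn).
Qed.

End WeylIndices.

Section LeftMultiplication.
Variables (K : comNzRingType) (n m : nat).

(* Left multiplication by x_i in normal order: q_k and the central variables
   act by multiplication, p_k by p_k + d/dq_k. *)
Definition wop (i : 'I_(2 * n + m)) (b : {mpoly K[2 * n + m]}) :=
  'X_i * b + \sum_(j | pqpair i j) mderiv j b.

Definition wmul (a b : {mpoly K[2 * n + m]}) : {mpoly K[2 * n + m]} :=
  polyact wop a b.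

End LeftMultiplication.

(* [p_k, q_k] = 1, [q_k, p_k] = -1, all other commutators vanish *)
Definition weyl_rel (n m : nat) (B : nzRingType)
    (y : 'I_(2 * n + m) -> B) : Prop :=
  forall i j, y i * y j - y j * y i = (pqpair i j)%:R - (pqpair j i)%:R.

Section OrderedActionTheory.
Variables (K : comNzRingType) (n m : nat) (V : lmodType K).
Local Notation s := (2 * n + m)%N.
Variable Y : 'I_s -> V -> V.
Hypothesis Ylin : forall i a u v, Y i (a *: u + v) = a *: Y i u + Y i v.
Hypothesis Yrel : forall i j v,
  Y i (Y j v) - Y j (Y i v) = ((pqpair i j)%:R - (pqpair j i)%:R) *: v.

Lemma Y0 i : Y i 0 = 0.
Proof.
have := Ylin i (-1) 0 0; rewrite scaler0 add0r scaleN1r.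
by rewrite addNr.
Qed.

Lemma YD i u v : Y i (u + v) = Y i u + Y i v.
Proof. by have := Ylin i 1 u v; rewrite !scale1r. Qed.

Lemma YZ i a u : Y i (a *: u) = a *: Y i u.
Proof. by have := Ylin i a u 0; rewrite Y0 !addr0. Qed.

Lemma iterYlin k i a u v :
  iter k (Y i) (a *: u + v) = a *: iter k (Y i) u + iter k (Y i) v.
Proof. by elim: k => //= k ->; rewrite Ylin. Qed.

Lemma ordact_seq_lin r al a u v :
  ordact_seq Y r al (a *: u + v) = a *: ordact_seq Y r al u + ordact_seq Y r al v.
Proof. by elim: r => //= k r ->; rewrite iterYlin. Qed.

Lemma ordact_lin al a u v :
  ordact Y al (a *: u + v) = a *: ordact Y al u + ordact Y al v.
Proof. exact: ordact_seq_lin. Qed.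

Lemma ordact0 v : ordact Y 0%MM v = v.
Proof.
by rewrite /ordact /ordact_seq; elim: (enum _) => //= k r ->; rewrite mnm0E.
Qed.

Lemma ordact0r al : ordact Y al 0 = 0.
Proof.
by have := ordact_lin al (-1) 0 0; rewrite scaler0 add0r scaleN1r addNr.
Qed.

Lemma ordactD al u v : ordact Y al (u + v) = ordact Y al u + ordact Y al v.
Proof. by have := ordact_lin al 1 u v; rewrite !scale1r. Qed.

Lemma ordactZ al a u : ordact Y al (a *: u) = a *: ordact Y al u.
Proof. by have := ordact_lin al a u 0; rewrite ordact0r !addr0. Qed.

Lemma iterYcomm (i k : 'I_s) e v : (k < i)%N ->
  Y i (iter e (Y k) v) =
  iter e (Y k) (Y i v) + (pqpair i k)%:R *: (e%:R *: iter e.-1 (Y k) v).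
Proof.
move=> lt_ki.
have nki : pqpair k i = false.
  by apply/negP => /pqpair_lt; rewrite ltnNge ltnW.
have com w : Y i (Y k w) = Y k (Y i w) + (pqpair i k)%:R *: w.
  by have /eqP := Yrel i k w; rewrite nki subr0 subr_eq addrC => /eqP.
elim: e => [|e IHe]; first by rewrite /= scale0r scaler0 addr0.
rewrite iterS com IHe YD -addrA /=; congr (_ + _).
rewrite !YZ -scalerDr; congr (_ *: _).
case: e {IHe} => [|e] /=; first by rewrite scale0r add0r scale1r.
by rewrite -[in RHS]natr1 scalerDl scale1r.
Qed.

Lemma ordact_seq_eq (r : seq 'I_s) (al be : 'X_{1..s}) v : {in r, al =1 be} ->
  ordact_seq Y r al v = ordact_seq Y r be v.
Proof.
elim: r => //= k r IH H; rewrite IH ?H ?mem_head // => j jr.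
by rewrite H // in_cons jr orbT.
Qed.

Lemma ordact_seqS (r : seq 'I_s) i (al : 'X_{1..s}) v :
  sorted (fun a b : 'I_s => (a < b)%N) r -> i \in r ->
  Y i (ordact_seq Y r al v) =
  ordact_seq Y r (al + U_(i))%MM v +
  \sum_(j <- r | pqpair i j) (al j)%:R *: ordact_seq Y r (al - U_(j))%MM v.
Proof.
have tr : transitive (fun a b : 'I_s => (a < b)%N).
  by move=> a b c; apply: ltn_trans.
elim: r => // k r IH /= sr; rewrite in_cons.
have lt_k j : j \in r -> (k < j)%N.
  by move: sr; rewrite (path_sortedE tr) => /andP[/allP + _] jr; apply.
have ne_k j : j \in r -> (k == j) = false.
  by move=> /lt_k; case: eqP => // ->; rewrite ltnn.
have Dk l be : l \in r -> (be + U_(l))%MM k = be k.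
  by move=> lr; rewrite mnmDE mnm1E eq_sym ne_k ?addn0.
have Bk l be : l \in r -> (be - U_(l))%MM k = be k.
  by move=> lr; rewrite mnmBE mnm1E eq_sym ne_k ?subn0.
case/orP => [/eqP ->|ir].
  rewrite big_seq_cond big1 ?addr0 => [|j].
    rewrite mnmDE mnm1E eqxx addn1 iterS; congr (Y k (iter _ _ _)).
    apply: ordact_seq_eq => j jr.
    by rewrite mnmDE mnm1E ne_k ?addn0.
  rewrite in_cons => /andP[+ /pqpair_lt jk].
  by case/orP => [/eqP E|/lt_k kj]; move: jk; rewrite ?E ?ltnn // ltnNge ltnW.
rewrite (iterYcomm _ _ (lt_k _ ir)) (IH (path_sorted sr) ir) Dk //.
have Ysum (P : pred 'I_s) (c : 'I_s -> K) F t :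
    iter (al k) (Y k) (\sum_(j <- t | P j) c j *: F j) =
    \sum_(j <- t | P j) c j *: iter (al k) (Y k) (F j).
  elim: t => [|j t IHt]; first by rewrite !big_nil; elim: (al k) => //= ? ->; rewrite Y0.
  by rewrite !big_cons; case: (P j); rewrite // iterYlin IHt.
rewrite -[X in iter _ _ (X + _)]scale1r iterYlin scale1r Ysum -addrA.
congr (_ + _); rewrite big_cons.
rewrite [X in X + _ = _](_ : _ =
   \sum_(j <- r | pqpair i j) (al j)%:R *:
      iter ((al - U_(j))%MM k) (Y k) (ordact_seq Y r (al - U_(j))%MM v)).
  rewrite addrC; case: (pqpair i k); last by rewrite scale0r add0r.
  rewrite scale1r mnmBE mnm1E eqxx subn1; congr (_ *: iter _ _ _ + _).
  by apply: ordact_seq_eq => j jr; rewrite mnmBE mnm1E ne_k ?subn0.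
rewrite big_seq_cond [RHS]big_seq_cond; apply: eq_bigr => j /andP[jr _].
by rewrite Bk.
Qed.

Lemma ordactS i al v :
  Y i (ordact Y al v) = ordact Y (al + U_(i))%MM v +
  \sum_(j | pqpair i j) (al j)%:R *: ordact Y (al - U_(j))%MM v.
Proof.
rewrite /ordact ordact_seqS ?mem_enum //.
  by congr (_ + _); rewrite big_enum_cond.
have := iota_ltn_sorted 0 s; rewrite -val_enum_ord sorted_map.
by apply: sub_sorted.
Qed.

Lemma polyactwE k (c : {mpoly K[s]}) v : (msize c <= k)%N ->
  polyact Y c v = \sum_(al : 'X_{1..s < k}) c@_al *: ordact Y al v.
Proof.
move=> le; pose I : subFinType _ := 'X_{1..s < k}; rewrite /polyact (big_mksub I) /=.
- by rewrite big_rmcond //= => i; move/memN_msupp_eq0 ->; rewrite scale0r.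
- exact: msupp_uniq.
- by move=> i /msize_mdeg_lt /leq_trans; apply.
Qed.

Lemma polyact_linl a (c d : {mpoly K[s]}) v :
  polyact Y (a *: c + d) v = a *: polyact Y c v + polyact Y d v.
Proof.
pose k := maxn (msize (a *: c + d)) (maxn (msize c) (msize d)).
rewrite !(@polyactwE k) ?leq_max ?leqnn ?orbT // scaler_sumr -big_split /=.
by apply: eq_bigr => al _; rewrite mcoeffD mcoeffZ scalerDl scalerA.
Qed.

Lemma polyact_linr (c : {mpoly K[s]}) a u v :
  polyact Y c (a *: u + v) = a *: polyact Y c u + polyact Y c v.
Proof.
rewrite /polyact scaler_sumr -big_split; apply: eq_bigr => al _ /=.
by rewrite ordact_lin scalerDr !scalerA mulrC.
Qed.

Lemma polyact0l v : polyact Y 0 v = 0.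
Proof. by rewrite /polyact msupp0 big_nil. Qed.

Lemma polyactDl c d v : polyact Y (c + d) v = polyact Y c v + polyact Y d v.
Proof. by have := polyact_linl 1 c d v; rewrite !scale1r. Qed.

Lemma polyactZl a c v : polyact Y (a *: c) v = a *: polyact Y c v.
Proof. by have := polyact_linl a c 0 v; rewrite polyact0l !addr0. Qed.

Lemma polyact_sum I (r : seq I) (P : pred I) (F : I -> {mpoly K[s]}) v :
  polyact Y (\sum_(i <- r | P i) F i) v = \sum_(i <- r | P i) polyact Y (F i) v.
Proof.
by apply: (big_morph (fun c => polyact Y c v)) => [c d|];
  rewrite ?polyactDl ?polyact0l.
Qed.

Lemma polyactX al v : polyact Y 'X_[al] v = ordact Y al v.
Proof. by rewrite /polyact msuppX big_seq1 mcoeffX eqxx scale1r. Qed.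

Lemma Ysum i J (r : seq J) (P : pred J) F :
  Y i (\sum_(j <- r | P j) F j) = \sum_(j <- r | P j) Y i (F j).
Proof. exact: (big_morph _ (YD i) (Y0 i)). Qed.

Lemma ordact_sum al J (r : seq J) (P : pred J) F :
  ordact Y al (\sum_(j <- r | P j) F j) = \sum_(j <- r | P j) ordact Y al (F j).
Proof. exact: (big_morph _ (ordactD al) (ordact0r al)). Qed.

Lemma wop_lin i a (u v : {mpoly K[s]}) :
  wop i (a *: u + v) = a *: wop i u + wop i v.
Proof.
rewrite /wop mulrDr -scalerAr scalerDr -!addrA; congr (_ + _).
rewrite [RHS]addrCA; congr (_ + _); rewrite scaler_sumr -big_split /=.
by apply: eq_bigr => j _; rewrite mderivD mderivZ.
Qed.

Lemma polyact_wop i (c : {mpoly K[s]}) v :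
  polyact Y (wop i c) v = Y i (polyact Y c v).
Proof.
elim/mpolyind: c => [|a al c _ _ IHc].
  by rewrite polyact0l Y0 /wop mulr0 big1 ?addr0 ?polyact0l // => j _; rewrite mderiv0.
rewrite wop_lin !polyact_linl Ylin IHc; congr (_ *: _ + _).
rewrite polyactX ordactS /wop polyactDl mulrC -mpolyXD polyactX.
rewrite polyact_sum; congr (_ + _); apply: eq_bigr => j _.
by rewrite mderivX polyactZl polyactX.
Qed.

Lemma polyact_ordact al (c : {mpoly K[s]}) v :
  polyact Y (ordact (@wop K n m) al c) v = ordact Y al (polyact Y c v).
Proof.
rewrite /ordact /ordact_seq; elim: (enum _) => //= k r <-.
by elim: (al k) => //= e <-; rewrite polyact_wop.
Qed.

Lemma polyact_wmul (c d : {mpoly K[s]}) v :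
  polyact Y (wmul c d) v = polyact Y c (polyact Y d v).
Proof.
have -> : wmul c d = \sum_(al <- msupp c) c@_al *: ordact (@wop K n m) al d.
  by [].
rewrite polyact_sum; apply: eq_bigr => al _.
by rewrite polyactZl polyact_ordact.
Qed.

End OrderedActionTheory.

Section WeylPolyRing.
Variables (K : comNzRingType) (n m : nat).
Local Notation s := (2 * n + m)%N.
Implicit Types a b c : {mpoly K[s]}.

Lemma wop_rel i j b : wop i (wop j b) - wop j (wop i b) =
  ((pqpair i j)%:R - (pqpair j i)%:R) *: b.
Proof.
pose d (k : 'I_s) c : {mpoly K[s]} := \sum_(l | pqpair k l) mderiv l c.
have dD k u v : d k (u + v) = d k u + d k v.
  by rewrite /d -big_split; apply: eq_bigr => l _; rewrite mderivD.
have dX k l u : d k ('X_l * u) = (pqpair k l)%:R *: u + 'X_l * d k u.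
  rewrite /d mulr_sumr; under eq_bigr do rewrite mderivM mderivX.
  rewrite big_split; congr (_ + _); case: (boolP (pqpair k l)) => kl.
    rewrite (bigD1 l) //= mnm1E eqxx !scale1r.
    have -> : (U_(l) - U_(l) = 0 :> 'X_{1..s})%MM.
      by apply/mnmP => t; rewrite mnmBE subnn mnm0E.
    rewrite mpolyX0 mul1r.
    rewrite big1 ?addr0 // => t /andP[_ tl].
    by rewrite mnm1E eq_sym (negPf tl) scale0r mul0r.
  rewrite scale0r big1 // => t kt; rewrite mnm1E.
  by case: eqP kt kl => [<- ->//|_ _ _]; rewrite scale0r mul0r.
have dd : d i (d j b) = d j (d i b).
  rewrite /d; under eq_bigr do rewrite raddf_sum.
  rewrite exchange_big /= ; apply: eq_bigr => k _; rewrite raddf_sum.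
  by apply: eq_bigr => l _; rewrite mderiv_comm.
have W k c : wop k c = 'X_k * c + d k c by [].
rewrite !W !mulrDr !dD !dX dd scalerBl; ring.
Qed.


Lemma ordact1 (al : 'X_{1..s}) : ordact (@wop K n m) al 1 = 'X_[al].
Proof.
rewrite /ordact /ordact_seq.
have tr : transitive (fun a b : 'I_s => (a < b)%N).
  by move=> a b c; apply: ltn_trans.
have : sorted (fun i j : 'I_s => (i < j)%N) (enum 'I_s).
  have := iota_ltn_sorted 0 s; rewrite -val_enum_ord sorted_map.
  by apply: sub_sorted.
have -> : 'X_[al] = \prod_(i <- enum 'I_s) 'X_i ^+ al i :> {mpoly K[s]}.
  by rewrite big_enum mpolyXE_id.
elim: (enum _) => [|k r IH] /= sr; first by rewrite big_nil.
rewrite (IH (path_sorted sr)) big_cons.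
have lt_k j : j \in r -> (k < j)%N.
  by move: sr; rewrite (path_sortedE tr) => /andP[/allP + _] jr; apply.
elim: (al k) => [|e IHe] /=; first by rewrite mul1r.
rewrite IHe /wop mulrA -exprS [X in _ + X]big1 ?addr0 // => j /pqpair_lt jk.
have dz t : (forall i, i \in t -> i != j) ->
    mderiv j (\prod_(i <- t) 'X_i ^+ al i : {mpoly K[s]}) = 0.
  elim: t => [|i t IHt] H; first by rewrite big_nil -(mpolyC1 s K) mderivC.
  rewrite big_cons mderivM IHt ?mulr0 ?addr0 => [|l lt]; last first.
    by rewrite H // in_cons lt orbT.
  rewrite mpolyXn mderivX mulmnE mnm1E (negPf (H i _)) ?mem_head //.
  by rewrite mul0n scale0r mul0r.
rewrite mderivM dz ?mulr0 ?addr0 => [|i /lt_k ki]; last first.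
  by apply: contraTneq jk => <-; rewrite -leqNgt ltnW.
rewrite mpolyXn mderivX mulmnE mnm1E.
by case: eqP jk => [->|]; rewrite ?ltnn // mul0n scale0r mul0r.
Qed.

Let wlin := @wop_lin K n m.
Let wrel := wop_rel.

Lemma wmulA : associative (@wmul K n m).
Proof. by move=> a b c; rewrite [RHS](polyact_wmul wlin wrel). Qed.

Lemma wmul1 : left_id 1 (@wmul K n m).
Proof. by move=> b; rewrite /wmul -mpolyX0 polyactX ordact0. Qed.

Lemma wmulr1 : right_id 1 (@wmul K n m).
Proof.
move=> b; rewrite /wmul /polyact [RHS]mpolyE.
by apply: eq_bigr => al _; rewrite ordact1.
Qed.

Lemma wmulDl : left_distributive (@wmul K n m) +%R.
Proof. by move=> a b c; rewrite /wmul polyactDl. Qed.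

Lemma wmulDr : right_distributive (@wmul K n m) +%R.
Proof.
by move=> a b c; have := polyact_linr wlin a 1 b c; rewrite !scale1r.
Qed.

Lemma wscalerAl k a b : k *: wmul a b = wmul (k *: a) b.
Proof. by rewrite /wmul polyactZl. Qed.

Lemma wscalerAr k a b : k *: wmul a b = wmul a (k *: b).
Proof.
have := polyact_linr wlin a k b 0; rewrite addr0 /wmul => ->.
have := polyact_linr wlin a (-1) 0 0.
by rewrite scaler0 add0r scaleN1r addNr => ->; rewrite addr0.
Qed.

End WeylPolyRing.

Definition weylPoly (K : comNzRingType) (n m : nat) : Type :=
  {mpoly K[2 * n + m]}.

HB.instance Definition _ (K : comNzRingType) n m :=
  GRing.Lmodule.on (weylPoly K n m).
HB.instance Definition _ (K : comNzRingType) n m :=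
  GRing.Zmodule_isNzRing.Build (weylPoly K n m)
    (@wmulA K n m) (@wmul1 K n m) (@wmulr1 K n m)
    (@wmulDl K n m) (@wmulDr K n m) (oner_neq0 {mpoly K[2 * n + m]}).
HB.instance Definition _ (K : comNzRingType) n m :=
  GRing.Lmodule_isLalgebra.Build K (weylPoly K n m) (@wscalerAl K n m).
HB.instance Definition _ (K : comNzRingType) n m :=
  GRing.Lalgebra_isAlgebra.Build K (weylPoly K n m) (@wscalerAr K n m).

Section WeylPoly.
Variables (K : comNzRingType) (n m : nat).
Local Notation s := (2 * n + m)%N.
Local Notation A := (weylPoly K n m).

Definition wgen (i : 'I_s) : A := 'X_i : {mpoly K[s]}.

Definition ordmon (al : 'X_{1..s}) : A := \prod_(i < s) wgen i ^+ al i.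

(* The degree of a nonzero element; wdeg 0 = 0 by convention. *)
Definition wdeg (a : A) : nat :=
  \max_(al <- msupp (a : {mpoly K[s]})) mdeg al.

(* deg of a self-map of A, read off on the generators *)
Definition enddeg (sigma : A -> A) : nat := \max_(i < s) wdeg (sigma (wgen i)).

Lemma wgenM i (b : A) : wgen i * b = wop i (b : {mpoly K[s]}) :> A.
Proof.
have E : wop i (1 : {mpoly K[s]}) = 'X_i.
  rewrite /wop mulr1 big1 ?addr0 // => j _.
  by rewrite -(mpolyC1 s K) mderivC.
change (wmul 'X_i (b : {mpoly K[s]}) = wop i (b : {mpoly K[s]})).
rewrite -E [LHS](polyact_wop (@wop_lin K n m) (@wop_rel K n m)).
by congr (wop i _); apply: (@wmul1 K n m).
Qed.

Lemma wgen_rel : weyl_rel wgen.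
Proof.
move=> i j; rewrite !wgenM.
have W k : wgen k = wop k (1 : {mpoly K[s]}) :> A.
  by rewrite -wgenM; apply/esym; apply: (@mulr1 A).
rewrite !W; apply: etrans (wop_rel i j (1 : {mpoly K[s]})) _.
transitivity ((((pqpair i j)%:R - (pqpair j i)%:R) : K) *: (1 : A)) => //.
by rewrite scalerBl !scaler_nat.
Qed.

Lemma ordmonM al (b : A) :
  ordmon al * b = ordact (@wop K n m) al (b : {mpoly K[s]}).
Proof.
rewrite /ordact /ordact_seq.
have -> : ordmon al = \prod_(i <- enum 'I_s) wgen i ^+ al i.
  by rewrite /ordmon [index_enum _]unlock -enumT.
elim: (enum _) => [|k r IH] /=; first by rewrite big_nil mul1r.
rewrite big_cons -mulrA IH; elim: (al k) => [|e IHe] /=; first by rewrite mul1r.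
by rewrite exprS -mulrA IHe wgenM.
Qed.

Lemma ordmonE al : ordmon al = 'X_[al] :> {mpoly K[s]}.
Proof. by rewrite -ordact1 -[LHS](@mulr1 A) ordmonM. Qed.

Lemma ordmon_span (a : A) :
  a = \sum_(al <- msupp (a : {mpoly K[s]})) (a : {mpoly K[s]})@_al *: ordmon al.
Proof.
by rewrite [LHS](@mpolyE s K); apply: eq_bigr => al _; rewrite ordmonE.
Qed.

Lemma ordmon_free (c : {mpoly K[s]}) :
  \sum_(al <- msupp c) c@_al *: ordmon al = 0 -> c = 0.
Proof. by rewrite -(ordmon_span (c : A)). Qed.

Section Universal.
Variables (B : algType K) (y : 'I_s -> B).
Hypothesis yrel : weyl_rel y.

Let Y i (v : B) := y i * v.

Let Ylin i a u v : Y i (a *: u + v) = a *: Y i u + Y i v.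
Proof. by rewrite /Y mulrDr scalerAr. Qed.

Let Yrel i j v :
  Y i (Y j v) - Y j (Y i v) = ((pqpair i j)%:R - (pqpair j i)%:R) *: v.
Proof.
rewrite /Y !mulrA -mulrBl yrel mulrBl scalerBl !scaler_nat.
by rewrite !mulr_natl.
Qed.

Let ev (a : A) : B := polyact Y (a : {mpoly K[s]}) 1.

Let ordactM al u v : ordact Y al (u * v) = ordact Y al u * v.
Proof.
rewrite /ordact /ordact_seq; elim: (enum _) => //= k r ->.
by elim: (al k) => //= e ->; rewrite /Y mulrA.
Qed.

Let evE (a : A) v : polyact Y (a : {mpoly K[s]}) v = ev a * v.
Proof.
rewrite /ev /polyact mulr_suml; apply: eq_bigr => al _.
by rewrite -[in LHS](mul1r v) ordactM scalerAl.
Qed.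

Let ev_linear : linear ev.
Proof. by move=> a u v; rewrite /ev polyact_linl. Qed.

Let ev_monoid : monoid_morphism ev.
Proof.
split; first by rewrite /ev -[1 : A]/(1 : {mpoly K[s]}) -mpolyX0 polyactX ordact0.
by move=> a b; rewrite -evE /ev -polyact_wmul.
Qed.

HB.instance Definition _ := GRing.isLinear.Build K A B _ ev ev_linear.
HB.instance Definition _ := GRing.isMonoidMorphism.Build A B ev ev_monoid.

Lemma weyl_universal_ex : exists f : {lrmorphism A -> B}, f \o wgen =1 y.
Proof.
exists ev => i /=; have := polyact_wop Ylin Yrel i 1 1.
have /= := evE (wgen i) 1; rewrite mulr1 => <-.
rewrite -[wop i 1](wgenM i 1) (@mulr1 A) => ->.
by rewrite -mpolyX0 polyactX ordact0 /Y mulr1.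
Qed.

End Universal.

Lemma weyl_universal (B : algType K) (y : 'I_s -> B) : weyl_rel y ->
  exists f : {lrmorphism A -> B}, f \o wgen =1 y /\
    forall g : {lrmorphism A -> B}, g \o wgen =1 y -> g =1 f.
Proof.
move=> /weyl_universal_ex[f Hf]; exists f; split=> // g Hg a.
rewrite (ordmon_span a) !linear_sum; apply: eq_bigr => al _.
rewrite !linearZ !rmorph_prod; congr (_ *: _); apply: eq_bigr => i _.
by rewrite !rmorphXn; congr (_ ^+ _); rewrite [LHS]Hg [RHS]Hf.
Qed.

End WeylPoly.

(* Main.v *)
From HB Require Import structures.
Require Import Defs.
From mathcomp Require Import all_boot all_order all_algebra.
From mathcomp Require Import mpoly.
From mathcomp Require Import zify.

Set Implicit Arguments.
Unset Strict Implicit.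
Unset Printing Implicit Defensive.

Import GRing.Theory.
Local Open Scope ring_scope.

(** Let g be the preimage of a generator x under the automorphism, e its degree,
    d the degree of the automorphism and s = t + 1 the number of generators;
    e <= d^t is to be shown.  The automorphism carries the right ideal g A
    onto x A, hence induces an injection of A / g A into A / x A, which
    multiplies degrees by at most d ([wsize_lrmorph_le]).  The associated
    graded algebra of A is a polynomial ring, so the degree is additive on
    products ([wsizeM]), and the degree filtration of A / g A grows like that
    of a hypersurface of degree e: in degrees at most N its dimension is
    e N^t / t! up to lower order terms.  For A / x A the dimension in degrees
    at most d N is (d N)^t / t! up to lower order terms.  Comparing the
    leading coefficients for N -> oo gives e <= d^t.

    Quotients are avoided by counting with the complete filtration.  If
    V_k is the space of elements of degree < k, the linear map
    (a, b) |-> (sigma a - x b, sigma^-1 b truncated to degree <= N - e)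
    from V_(N+1) x V_(dN) to V_(dN+1) x V_(N+1-e) is injective: in its kernel
    a = g (sigma^-1 b), and additivity of the degree bounds sigma^-1 b by
    degree N - e, so that the truncation loses nothing.  This gives
    [card_automorphism_le], and the growth of binomial coefficients
    ([card_bmultinom_growth], [leq_expn_of_poly_bound]) does the rest. *)

(** * Growth of the number of monomials *)

(** The form d^t L^t + O(L^(t-1)) of (d L + 1)^t, with the exponent shifted by
    one so that t - 1 makes sense. *)
Lemma expn_linear_le (d t : nat) : exists C : nat, forall L : nat, (0 < L)%N ->
  ((d * L + 1) ^ t.+1 <= (d * L) ^ t.+1 + C * L ^ t)%N.
Proof.
elim: t => [|t [C HC]]; first by exists 1%N => L _; rewrite !expn1.
exists (d ^ t.+1 + d.+1 * C)%N => L L0.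
rewrite expnS; apply: leq_trans (leq_mul (leqnn _) (HC L L0)) _.
have -> : ((d * L) ^ t.+2 = d * L * (d * L) ^ t.+1)%N by rewrite expnS.
rewrite mulnDr mulnDl mul1n expnMn mulnDl [in leqRHS](expnS L t).
have : (0 < L ^ t)%N by rewrite expn_gt0 L0.
move: (d ^ t.+1)%N (L ^ t.+1)%N (L ^ t)%N (expnS L t) => D X Y -> Y0.
nia.
Qed.

(** Comparison of the leading coefficients of two polynomials in M. *)
Lemma leq_expn_of_poly_bound (e d c t : nat) :
  (forall M, e * M ^ t <= (d * M + c) ^ t)%N -> (e <= d ^ t)%N.
Proof.
case: t => [|t] bnd; first by have := bnd 0%N; rewrite !expn0 muln1.
rewrite leqNgt; apply/negP => lt_e.
have [C HC] := expn_linear_le d t.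
(* M = c' L makes the right-hand side at most (c' (d L + 1))^t, so that c'^t
   cancels; L > C then beats the error term. *)
pose L := C.+1; pose c' := c.+1.
have: ((d ^ t.+1).+1 * L ^ t.+1 <= (d * L + 1) ^ t.+1)%N.
  rewrite -(@leq_pmul2r (c' ^ t.+1)) ?expn_gt0 // -mulnA -!expnMn.
  apply: leq_trans (leq_trans (leq_mul lt_e (leqnn _)) (bnd _)) _.
  by rewrite leq_exp2r // mulnDl mul1n mulnA leq_add2l leqnSn.
apply/negP; rewrite -ltnNge; apply: leq_ltn_trans (HC L isT) _.
by rewrite expnMn mulSn addnC ltn_add2r (expnS L) ltn_pmul2r ?expn_gt0.
Qed.

(** The monomials of degree exactly k are the new ones. *)
Lemma card_bmultinomS t k :
  #|{: 'X_{1..t.+1 < k.+1}}| = (#|{: 'X_{1..t.+1 < k}}| + 'C(k + t, k))%N.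
Proof.
rewrite -(size_basis t k) !cardE -!(size_map (@bmnm _ _)) -size_cat.
apply/perm_size/uniq_perm.
- by rewrite (map_inj_uniq val_inj) enum_uniq.
- rewrite cat_uniq (map_inj_uniq val_inj) enum_uniq uniq_basis andbT /=.
  apply/hasPn => m; rewrite -basis_cover => /eqP mk.
  apply/mapP => -[[m' lt] _ /= E].
  by move: lt; rewrite -E mk ltnn.
- move=> m; rewrite mem_cat -basis_cover.
  have E j : (m \in [seq bmnm i | i : 'X_{1..t.+1 < j}]) = (mdeg m < j)%N.
    apply/mapP/idP => [[[m' lt] _ ->] //|lt].
    by exists (BMultinom lt); rewrite ?mem_enum.
  by rewrite !E ltnS leq_eqVlt orbC.
Qed.

Lemma expn_le_fact_bin t k : (k.+1 ^ t <= t`! * 'C(k + t, k))%N.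
Proof.
rewrite -[k in 'C(_, k)](addnK t) bin_sub ?leq_addl // mulnC bin_ffact.
elim: t => [|t IH]; first by rewrite expn0 ffactn0.
by rewrite expnS addnS ffactSS leq_mul // ltnS leq_addr.
Qed.

Lemma fact_bin_le_expn t k : (t`! * 'C(k + t, k) <= (k + t) ^ t)%N.
Proof.
rewrite -[k in 'C(_, k)](addnK t) bin_sub ?leq_addl // mulnC bin_ffact.
rewrite ffact_prod -[X in (_ ^ X)%N]card_ord -prod_nat_const.
by apply: leq_prod => i _; apply: leq_subr.
Qed.

(** Each of the e degrees M + 1, ..., M + e contributes at least as many
    monomials as degree M does. *)
Lemma card_bmultinom_growth t e M :
  (#|{: 'X_{1..t.+1 < M.+1}}| + e * 'C(M + t, M) <=
   #|{: 'X_{1..t.+1 < M.+1 + e}}|)%N.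
Proof.
elim: e => [|e IH]; first by rewrite mul0n !addn0.
rewrite addnS (card_bmultinomS t (M.+1 + e)) mulSnr addnA leq_add //.
rewrite -(bin_sub (leq_addr t M)) -(bin_sub (leq_addr t _)) !addKn.
by apply: leq_bin2l; lia.
Qed.

(** * Spaces of polynomials of bounded degree *)

Lemma dim_inj_le (K : fieldType) (U W : vectType K) (f : U -> W) :
  linear f -> (forall u, f u = 0 -> u = 0) -> (dim U <= dim W)%N.
Proof.
move=> fL fI.
pose fM := GRing.isLinear.Build K U W _ f fL.
pose F : {linear U -> W} := HB.pack f fM.
have F0 : lker (linfun F) == 0%VS.
  apply/lker0P => x y; rewrite !lfunE /= => E; apply/eqP.
  rewrite -subr_eq0; apply/eqP/fI.
  have fB : f (x - y) = f x - f y by apply: (linearB F).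
  by rewrite fB E subrr.
rewrite -!dimvf -(limg_dim_eq (f := linfun F)) ?dimvS ?subvf //.
by rewrite (eqP F0) capv0.
Qed.

Section Coordinates.
Variables (K : fieldType) (s : nat).

(** [of_coords] and [coords] identify the polynomials of degree < k with a space
    whose dimension is the number of monomials of degree < k; [coords] also
    truncates the polynomials of higher degree. *)
Definition of_coords k (u : {ffun 'X_{1..s < k} -> K^o}) : {mpoly K[s]} :=
  \sum_(al : 'X_{1..s < k}) u al *: 'X_[al].

Definition coords k (p : {mpoly K[s]}) : {ffun 'X_{1..s < k} -> K^o} :=
  [ffun al : 'X_{1..s < k} => p@_al].

Lemma msize_leP k (p : {mpoly K[s]}) :
  reflect (forall m, m \in msupp p -> mdeg m < k)%N (msize p <= k)%N.
Proof.
apply: (iffP idP) => [le m /msize_mdeg_lt lt|H]; first exact: leq_trans lt le.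
by rewrite msizeE; apply/bigmax_leqP_seq => m /H.
Qed.

Lemma of_coords_linear k : linear (@of_coords k).
Proof.
move=> a u v; rewrite /of_coords scaler_sumr -big_split /=.
apply: eq_bigr => al _.
by rewrite !ffunE scalerDl scalerA.
Qed.

Lemma coords_linear k : linear (@coords k).
Proof. by move=> a u v; apply/ffunP => al; rewrite !ffunE mcoeffD mcoeffZ. Qed.

Lemma coordsK k p : (msize p <= k)%N -> of_coords (coords k p) = p.
Proof.
move=> le; rewrite [RHS](mpolywE le); apply: eq_bigr => al _.
by rewrite ffunE.
Qed.

Lemma of_coordsK k : cancel (@of_coords k) (@coords k).
Proof.
move=> u; apply/ffunP => al; rewrite ffunE raddf_sum (bigD1 al) //= big1 ?addr0.
  by rewrite mcoeffZ mcoeffX eqxx mulr1.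
by move=> be ne; rewrite mcoeffZ mcoeffX (inj_eq val_inj) (negPf ne) mulr0.
Qed.

Lemma msize_of_coords k u : (msize (@of_coords k u) <= k)%N.
Proof.
apply/msize_leP => m; rewrite mcoeff_msupp raddf_sum /=.
apply: contraR => /negP H; rewrite big1 // => al _.
rewrite mcoeffZ mcoeffX; case: eqP => [E|]; last by rewrite mulr0.
by case: H; rewrite -E; case: (al).
Qed.

End Coordinates.

(** * The degree filtration *)

Section Degree.
Variables (n m : nat).
Local Notation s := (2 * n + m)%N.

Section Ring.
Variable K : fieldType.
Implicit Types a b p : {mpoly K[s]}.

Lemma msize_mderiv_le j p k : (msize p <= k.+1)%N ->
  (msize (mderiv j p) <= k)%N.
Proof.
move=> /msize_leP H; apply/msize_leP => al.
rewrite mcoeff_msupp mcoeff_deriv => nz.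
have : (al + U_(j))%MM \in msupp p.
  by rewrite mcoeff_msupp; apply: contraNneq nz => ->; rewrite mul0rn.
by move=> /H; rewrite mdegD mdeg1 addn1 ltnS.
Qed.

Lemma msizeXM_le al p k : (msize p <= k)%N ->
  (msize ('X_[al] * p) <= mdeg al + k)%N.
Proof.
case: (eqVneq p 0) => [->|nz] H; first by rewrite mulr0 msize0.
have nX : ('X_[al] : {mpoly K[s]}) != 0 by rewrite -msize_poly_eq0 msizeX.
by rewrite msizeM // msizeX addSn leq_add2l.
Qed.

(** To leading order, left multiplication by a generator is the commutative
    product: the correction is a sum of derivatives. *)
Lemma msize_wop i p k : (msize p <= k.+1)%N ->
  (msize (wop i p - 'X_i * p) <= k)%N.
Proof.
move=> H; rewrite /wop addrAC subrr add0r.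
apply: leq_trans (msize_sum _ _ _) _; apply/bigmax_leqP => j _.
exact: msize_mderiv_le.
Qed.

Lemma msize_ordact al p k : (msize p <= k.+1)%N ->
  (msize (ordact (@wop K n m) al p - 'X_[al] * p) <= mdeg al + k)%N.
Proof.
move=> Hp.
(* u has the degree expected after j factors and agrees with v to leading
   order; each further generator preserves this. *)
pose P j (u v : {mpoly K[s]}) :=
  ((msize u <= (j + k).+1) && (msize (u - v) <= j + k))%N.
have step i j u v : P j u v -> P j.+1 (wop i u) ('X_i * v).
  case/andP => Hu Huv; have Hw := msize_wop i Hu.
  have HX q l : (msize q <= l)%N -> (msize ('X_i * q : {mpoly K[s]}) <= l.+1)%N.
    by move=> Hq; have := msizeXM_le U_(i)%MM Hq; rewrite mdeg1.
  rewrite /P addSn; apply/andP; split.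
    rewrite -[wop i u](subrK ('X_i * u)); apply: leq_trans (msizeD_le _ _) _.
    by rewrite geq_max HX // andbT (leq_trans Hw) //; lia.
  rewrite -[wop i u](subrK ('X_i * u)) -addrA -mulrBr.
  apply: leq_trans (msizeD_le _ _) _.
  by rewrite geq_max HX // andbT (leq_trans Hw) //; lia.
rewrite mpolyXE_id mdegE -!big_enum /ordact /=.
suff /andP[]: P (\sum_(i <- enum 'I_s) al i)%N
   (ordact_seq (@wop K n m) (enum 'I_s) al p)
   ((\prod_(i <- enum 'I_s) 'X_i ^+ al i) * p) by [].
elim: (enum _) => [|i r IH] /=.
  by rewrite !big_nil mul1r /P subrr msize0 add0n Hp.
rewrite !big_cons -mulrA; elim: (al i) => [|e IHe]; first by rewrite mul1r.
by rewrite exprS -mulrA; apply: step.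
Qed.

Lemma msize_wmul_sub a b j k : (msize a <= j.+1)%N -> (msize b <= k.+1)%N ->
  (msize (wmul a b - a * b) <= j + k)%N.
Proof.
move=> /msize_leP Ha Hb.
rewrite {2}(mpolyE a) mulr_suml /wmul /polyact -sumrB.
apply: leq_trans (msize_sum _ _ _) _; apply/bigmax_leqP_seq => al /Ha al_a _.
rewrite -scalerAl -scalerBr; apply: leq_trans (msizeZ_le _ _) _.
apply: leq_trans (msize_ordact al Hb) _; lia.
Qed.

(** The commutative product, whose degree is known over a domain, dominates the
    lower order correction. *)
Lemma msize_wmul a b : a != 0 -> b != 0 ->
  msize (wmul a b) = (msize a + msize b).-1.
Proof.
move=> na nb.
have Mab : msize (a * b) = (msize a + msize b).-1 by apply: msizeM.
have [a0 b0] : (0 < msize a /\ 0 < msize b)%N by rewrite !lt0n !msize_poly_eq0.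
have := @msize_wmul_sub a b (msize a).-1 (msize b).-1.
rewrite !prednK // !leqnn => /(_ isT isT) lt.
have lt' : (msize (wmul a b - a * b) < msize (a * b))%N.
  by rewrite Mab; apply: leq_ltn_trans lt _; lia.
rewrite -Mab; apply/eqP; rewrite eqn_leq; apply/andP; split.
  rewrite -[wmul a b](subrK (a * b)); apply: leq_trans (msizeD_le _ _) _.
  by rewrite geq_max leqnn andbT ltnW.
have : (msize (a * b) <= maxn (msize (wmul a b)) (msize (wmul a b - a * b)))%N.
  rewrite -{1}[a * b](subKr (wmul a b)); apply: leq_trans (msizeD_le _ _) _.
  by rewrite msizeN.
by rewrite leq_max [X in _ || X]leqNgt lt' orbF.
Qed.

End Ring.

Variable K : fieldType.
Local Notation A := (weylPoly K n m).
Implicit Types a b : A.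

(** One more than the degree, and 0 for the zero element, so that wsize a <= k
    says that a lies in the k-th step of the filtration, zero included. *)
Definition wsize (a : A) : nat := msize (a : {mpoly K[s]}).

Local Arguments wsize a%_R.

Lemma wsize_eq0 a : (wsize a == 0%N) = (a == 0).
Proof. exact: msize_poly_eq0. Qed.

Lemma wdegE a : wdeg a = (wsize a).-1.
Proof.
rewrite /wdeg /wsize; apply/eqP; rewrite eqn_leq; apply/andP; split.
  apply/bigmax_leqP_seq => al al_a _; have lt := msize_mdeg_lt al_a.
  by rewrite -ltnS prednK //; apply: leq_ltn_trans lt.
rewrite -subn1 leq_subLR add1n; apply/msize_leP => al al_a.
by rewrite ltnS; apply: (leq_bigmax_seq (F := fun al => mdeg al)).
Qed.

Lemma wsize_wgen i : wsize (wgen K i) = 2.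
Proof. by rewrite /wsize msizeX mdeg1. Qed.

Lemma wsizeM a b : a != 0 -> b != 0 -> wsize (a * b) = (wsize a + wsize b).-1.
Proof. exact: msize_wmul. Qed.

Lemma wsizeM_le a b j k : (wsize a <= j.+1)%N -> (wsize b <= k.+1)%N ->
  (wsize (a * b) <= (j + k).+1)%N.
Proof.
have [->|na] := eqVneq a 0; first by rewrite mul0r /wsize msize0.
have [->|nb] := eqVneq b 0; first by rewrite mulr0 /wsize msize0.
by rewrite wsizeM //; lia.
Qed.

Lemma wsize_lrmorph_le (f : {lrmorphism A -> A}) a k : (wsize a <= k.+1)%N ->
  (wsize (f a) <= (enddeg f * k).+1)%N.
Proof.
move=> /msize_leP le_a; rewrite (ordmon_span a) linear_sum.
apply: leq_trans (msize_sum _ _ _) _; apply/bigmax_leqP_seq => al /le_a al_a _.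
rewrite linearZ; apply: leq_trans (msizeZ_le _ _) _.
suff le : (wsize (f (ordmon K al)) <= (enddeg f * mdeg al).+1)%N.
  by apply: leq_trans le _; rewrite ltnS leq_mul2l -ltnS al_a orbT.
rewrite /ordmon rmorph_prod mdegE big_distrr /=.
apply: (big_rec2 (fun x y => wsize x <= y.+1)%N);
  first by rewrite /wsize msize1.
move=> i y x _ IH; apply: wsizeM_le => //; rewrite rmorphXn.
have gen_le : (wsize (f (wgen K i)) <= (enddeg f).+1)%N.
  have : (wdeg (f (wgen K i)) <= enddeg f)%N.
    exact: (leq_bigmax (F := fun j => wdeg (f (wgen K j)))).
  by rewrite wdegE; lia.
elim: (al i) => [|e IHe]; first by rewrite muln0 expr0 /wsize msize1.
by rewrite exprS mulnS; apply: wsizeM_le.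
Qed.

(** * Comparing the filtrations along an automorphism *)

Section Count.
Variables (f : {lrmorphism A -> A}) (g : A -> A).
Hypotheses (fK : cancel f g) (gK : cancel g f).

(** With e and d the degrees of g x_i and f, and V_k the elements of degree
    < k, this says that dim V_(N+1) - dim V_(N+1-e), the dimension of the part
    of degree <= N of A / (g x_i) A, is at most dim V_(dN+1) - dim V_(dN), the
    dimension of the part of degree <= d N of A / x_i A. *)
Lemma card_automorphism_le i N :
  (#|{: 'X_{1..s < N.+1}}| + #|{: 'X_{1..s < enddeg f * N}}| <=
   #|{: 'X_{1..s < (enddeg f * N).+1}}| +
     #|{: 'X_{1..s < N.+1 - wdeg (g (wgen K i))}}|)%N.
Proof.
set D := (enddeg f * N)%N; set e := wdeg _.
have gL : linear g by apply: can2_linear fK gK.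
pose U := ({ffun 'X_{1..s < N.+1} -> K^o} * {ffun 'X_{1..s < D} -> K^o})%type.
pose W := ({ffun 'X_{1..s < D.+1} -> K^o} *
           {ffun 'X_{1..s < N.+1 - e} -> K^o})%type.
pose T (u : U) : W :=
  (coords D.+1 (f (of_coords u.1) - wgen K i * of_coords u.2 : A),
   coords (N.+1 - e) (g (of_coords u.2))).
have TL : linear T.
  move=> a u v; congr pair; rewrite -coords_linear; congr coords.
    rewrite !of_coords_linear.
    rewrite [f _](linearP f) [_ * _](@mulrDr A).
    rewrite -[_ * (a *: _)](@scalerAr K A).
    rewrite opprD [LHS](@addrACA A).
    by rewrite [in RHS](@scalerBr K A).
  by rewrite of_coords_linear gL.
have Tinj u : T u = 0 -> u = 0.
  case: u => u v /= [/= Ta Tb].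
  set a : A := of_coords u in Ta; set b : A := of_coords v in Ta Tb.
  have sa : (wsize a <= N.+1)%N by apply: msize_of_coords.
  have sb : (wsize b <= D)%N by apply: msize_of_coords.
  (* x_i has degree 1 and b degree < d N, so the difference has degree at most
     d N and vanishes with its coordinates. *)
  have ab : f a = wgen K i * b.
    apply/eqP; rewrite -subr_eq0; apply/eqP.
    rewrite -[LHS](@coordsK K s D.+1) ?Ta.
      by apply: big1 => al _; rewrite ffunE scale0r.
    apply: leq_trans (msizeD_le _ _) _; rewrite msizeN geq_max.
    rewrite [X in X && _](wsize_lrmorph_le f sa) /=.
    have [->|nb] := eqVneq b 0; first by rewrite mulr0 msize0.
    by rewrite [X in (X <= _)%N]wsizeM ?wsize_wgen // -wsize_eq0 wsize_wgen.
  have ag : a = g (wgen K i) * g b.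
    by rewrite -[a]fK ab -{1}[wgen K i]gK -{1}[b]gK -rmorphM fK.
  have gb0 : g b = 0.
    have [//|nz] := eqVneq (g b) 0.
    have ng : g (wgen K i) != 0.
      apply/eqP => /(congr1 f); rewrite gK rmorph0 => /eqP.
      by rewrite -wsize_eq0 wsize_wgen.
    (* A nonzero g b has degree deg a - e <= N - e. *)
    rewrite -[LHS](@coordsK K s (N.+1 - e)%N) ?Tb.
      by apply: big1 => al _; rewrite ffunE scale0r.
    move: sa; rewrite ag wsizeM //.
    rewrite /e wdegE; rewrite -wsize_eq0 in ng; rewrite -/(wsize _); lia.
  have a0 : a = 0 by rewrite ag gb0 mulr0.
  have b0 : b = 0 by rewrite -[b]gK gb0 rmorph0.
  rewrite -[u]of_coordsK -[v]of_coordsK -/a -/b a0 b0.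
  by congr pair; apply/ffunP => al; rewrite !ffunE mcoeff0.
have := dim_inj_le TL Tinj.
have -> : dim U =
  (#|{: 'X_{1..s < N.+1}}| * 1 + #|{: 'X_{1..s < D}}| * 1)%N by [].
have -> : dim W =
  (#|{: 'X_{1..s < D.+1}}| * 1 + #|{: 'X_{1..s < N.+1 - e}}| * 1)%N by [].
by rewrite !muln1.
Qed.

End Count.

End Degree.

(** * The degree bound *)

Theorem theorem1p2 (K : fieldType) (charK0 : [pchar K]%R =i pred0)
    (n m : nat) (s_ge1 : (1 <= 2 * n + m)%N)
    (sigma : {lrmorphism weylPoly K n m -> weylPoly K n m})
    (sigmaV : weylPoly K n m -> weylPoly K n m)
    (sigmaK : cancel sigma sigmaV) (sigmaVK : cancel sigmaV sigma) :
  (enddeg sigmaV <= enddeg sigma ^ (2 * n + m - 1))%N.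
Proof.
apply/bigmax_leqP => i _; set e := wdeg _.
have cnt := card_automorphism_le sigmaK sigmaVK i.
have Es : (2 * n + m = (2 * n + m - 1).+1)%N by rewrite subn1 prednK.
have {}cnt N : (#|{: 'X_{1..(2 * n + m - 1).+1 < N.+1}}| +
     #|{: 'X_{1..(2 * n + m - 1).+1 < enddeg sigma * N}}| <=
   #|{: 'X_{1..(2 * n + m - 1).+1 < (enddeg sigma * N).+1}}| +
     #|{: 'X_{1..(2 * n + m - 1).+1 < N.+1 - e}}|)%N.
  by have := cnt N; rewrite -/e; move: (e) (enddeg sigma); rewrite -Es.
(* Degree N = M + e makes N + 1 - e positive and the smallest degree in the
   difference equal to M + 1; the term d e + t absorbs the shifts. *)
move: (2 * n + m - 1)%N (enddeg sigma) cnt => t d cnt.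
apply: (@leq_expn_of_poly_bound e d (d * e + t) t) => M.
have := cnt (M + e)%N.
rewrite (card_bmultinomS t (d * (M + e))) -addSn addnK.
have := card_bmultinom_growth t e M.
set V1 := #|_|; set V2 := #|_|; set V3 := #|_| => gr cnt'.
have {}gr : (e * 'C(M + t, M) <= 'C(d * (M + e) + t, d * (M + e)))%N by lia.
rewrite addnA -mulnDr; apply: leq_trans (fact_bin_le_expn _ _).
apply: leq_trans (leq_mul (leqnn _) gr); rewrite mulnCA leq_mul //.
apply: leq_trans (expn_le_fact_bin _ _).
by case: t {cnt cnt' V1 V2 V3 gr} => // t; rewrite leq_exp2r.
Qed.
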